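(* Let $NC=\mathbb{Q}\langle y_1,y_2,\ldots\rangle$ be the free associative algebra, set $y_0=1$, and let $A_{\mathcal{E}}=NC/\langle\chi_2,\chi_4,\ldots\rangle$, where $\chi_{2m}=\sum_{r+s=2m}(-1)^ry_ry_s$. For a composition $\alpha=\alpha_1\cdots\alpha_k$, write: - $y_\alpha=y_{\alpha_1}\cdots y_{\alpha_k}$ (the flag-$f$ operator of Eulerian posets); - $\mathfrak{h}_\alpha=(-1)^{\ell(\alpha)}\sum_{\beta\succcurlyeq\alpha}(-1)^{\ell(\beta)}y_\beta$ (the flag-$h$ operator of Eulerian posets), viewed in $A_{\mathcal{E}}$. Then there is a well-defined algebra homomorphism $\psi:A_{\mathcal{E}}\to\mathbb{Q}\otimes\Omega$ with $\psi(y_i)=q_i$. It satisfies $\psi(y_\alpha)=q_{\alpha_1}\cdots q_{\alpha_k}$ and $\psi(\mathfrak{h}_\alpha)=\mathfrak{r}_\alpha$ for every composition $\alpha$.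
   Context: A composition $\alpha=\alpha_1\cdots\alpha_k$ is a finite sequence of positive integers with length $\ell(\alpha)=k$. $\beta\succcurlyeq\alpha$ means $\beta$ is a coarsening of $\alpha$, i.e. obtained by adding together adjacent parts of $\alpha$. Set $q_0=1$ and $q_n=0$ for $n<0$. Here $q_n=Q_{(n)}$ is the single-row skew Schur $Q$-function: the sum over weakly increasing fillings of a row of $n$ cells by $1'<1<2'<2<\cdots$ using each primed letter at most once, of $\prod_i x_i^{(\#i+\#i')}$. Put $\Omega=\mathbb{Z}[q_1,q_2,\ldots]$. A ribbon is a connected skew diagram (English convention) without $2\times2$ block, identified with the composition of its row lengths read from top to bottom. For a ribbon $\alpha=\nu/\kappa$, the ribbon Schur $Q$-function is $\mathfrak{r}_\alpha=\det(q_{\nu_i-\kappa_j-i+j})_{i,j=1}^{\ell(\nu)}$. *)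

(* Defs.v *)
From HB Require Import structures.
From mathcomp Require Import all_boot all_order all_algebra.
From mathcomp Require Import finmap.
From mathcomp.multinomials Require Import monalg.
From mathcomp Require Import boolp classical_sets functions cardinality fsbigop.

Set Implicit Arguments.
Unset Strict Implicit.
Unset Printing Implicit Defensive.

Import GRing.Theory.
Local Open Scope ring_scope.
Local Open Scope classical_set_scope.

Lemma finite_bounded_seq (T : choiceType) (X : {fset T}) (n : nat) :
  finite_set [set s : seq T | (size s <= n)%N /\ {subset s <= X}].
Proof.
elim: n => [|n IHn].
  apply: (sub_finite_set _ (finite_set1 [::])) => s /= [].
  by rewrite leqn0 size_eq0 => /eqP ->.
have fX : finite_set [set` X] by exact: finite_fset.
have fU : finite_set ([set [::]] `|`
    [set x :: s | x in [set` X] &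
                  s in [set s : seq T | (size s <= n)%N /\ {subset s <= X}]]).
  rewrite finite_setU; split; first exact: finite_set1.
  exact: finite_image2.
apply: (sub_finite_set _ fU) => -[|x s] /= [szs sX]; first by left.
right; exists x; first by apply: sX; rewrite inE eqxx.
exists s => //; split => // y ys; apply: sX.
by rewrite inE ys orbT.
Qed.

(* The index i : nat of a monomial stands for the variable x_(i+1). *)
Notation monom := {cmonom nat}.

Definition splits (m : monom) : set (monom * monom) :=
  [set p | mmul p.1 p.2 = m].

Lemma finite_splits m : finite_set (splits m).
Proof.
pose S := finsupp m.
pose X := seq_fset tt (iota 0 (\max_(i <- S) m i).+1).
pose B := [set s : seq nat | (size s <= size S)%N /\ {subset s <= X}].
pose dec (s : seq nat) : monom := [cmonom nth 0%N s (index i S) | i in S]%M.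
have fB : finite_set (dec @` B) by apply/finite_image/finite_bounded_seq.
have fD d e : mmul d e = m -> (dec @` B) d.
  move=> de; have le_d i : (d i <= m i)%N by rewrite -de cmM leq_addr.
  exists [seq d i | i <- S]; first split; first by rewrite size_map.
    move=> _ /mapP[i im ->]; rewrite seq_fsetE mem_iota /= add0n ltnS.
    by apply: leq_trans (le_d i) _; exact: leq_bigmax_seq.
  apply/eqP/cmP => i; rewrite /dec cmE fsfunE.
  case: ifPn => [iS|]; first by rewrite (nth_map 0%N) ?index_mem ?nth_index.
  by rewrite -cmE_eq0 => /eqP mi0; have := le_d i; rewrite mi0 leqn0 => /eqP.
apply: (sub_finite_set _ (finite_setX fB fB)) => -[d e] /= de.
by split; [exact: fD de | apply: (fD _ d); rewrite mulmC].
Qed.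

Definition fsplits m : {fset monom * monom} := fset_set (splits m).

Lemma mem_fsplits m p : (p \in fsplits m) = (mmul p.1 p.2 == m).
Proof.
rewrite in_fset_set; last exact: finite_splits.
by apply/idP/eqP; rewrite inE.
Qed.

Section PowerSeries.
Variable R : comNzRingType.

Record fps := Fps { fcoef : monom -> R }.

HB.instance Definition _ := gen_eqMixin fps.
HB.instance Definition _ := gen_choiceMixin fps.

Implicit Types f g h : fps.

Lemma fpsP f g : (forall m, fcoef f m = fcoef g m) -> f = g.
Proof. by case: f g => [f] [g] /= fg; congr Fps; apply/funext. Qed.

Definition fps_zero := Fps (fun=> 0).
Definition fps_opp f := Fps (fun m => - fcoef f m).
Definition fps_add f g := Fps (fun m => fcoef f m + fcoef g m).
Definition fps_one := Fps (fun m => (m == mone)%:R).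
Definition fps_mul f g :=
  Fps (fun m => \sum_(p \in splits m) fcoef f p.1 * fcoef g p.2).
Definition fps_scale (c : R) f := Fps (fun m => c * fcoef f m).

Fact fps_addA : associative fps_add.
Proof. by move=> f g h; apply: fpsP => m /=; rewrite addrA. Qed.
Fact fps_addC : commutative fps_add.
Proof. by move=> f g; apply: fpsP => m /=; rewrite addrC. Qed.
Fact fps_add0 : left_id fps_zero fps_add.
Proof. by move=> f; apply: fpsP => m /=; rewrite add0r. Qed.
Fact fps_addN : left_inverse fps_zero fps_opp fps_add.
Proof. by move=> f; apply: fpsP => m /=; rewrite addNr. Qed.

HB.instance Definition _ :=
  GRing.isZmodule.Build fps fps_addA fps_addC fps_add0 fps_addN.

Lemma fcoef_mul f g m :
  fcoef (fps_mul f g) m = \sum_(p <- fsplits m) fcoef f p.1 * fcoef g p.2.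
Proof. by rewrite /= fsbig_finite //; exact: finite_splits. Qed.

Fact fps_mulC : commutative fps_mul.
Proof.
move=> f g; apply: fpsP => m; rewrite !fcoef_mul.
have sw : perm_eq (fsplits m) [seq (p.2, p.1) | p <- fsplits m].
  apply: uniq_perm; first exact: fset_uniq.
    by rewrite map_inj_uniq ?fset_uniq // => -[a b] [c d] /= [-> ->].
  move=> [a b]; rewrite mem_fsplits /=; apply/eqP/mapP => [ab|[[c d]]].
    by exists (b, a); rewrite // mem_fsplits /= mulmC; exact/eqP.
  by rewrite mem_fsplits /= => /eqP cd [-> ->]; rewrite mulmC.
rewrite (perm_big _ sw) /= big_map.
by apply: eq_bigr => p _; rewrite mulrC.
Qed.

Fact fps_mul1 : left_id fps_one fps_mul.
Proof.
move=> f; apply: fpsP => m; rewrite fcoef_mul.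
have m1 : (mone, m) \in fsplits m by rewrite mem_fsplits /= mul1m.
rewrite (big_rem _ m1) /= eqxx mul1r big_seq big1 ?addr0 // => -[a b].
rewrite mem_rem_uniq ?fset_uniq // inE mem_fsplits /= => /andP[ne /eqP ab].
have [a1|_] := eqVneq a mone; last by rewrite mul0r.
by move: ne; rewrite -ab a1 mul1m eqxx.
Qed.

Fact fps_mulDl : left_distributive fps_mul +%R.
Proof.
move=> f g h; apply: fpsP => m.
rewrite [RHS]/(fcoef (fps_mul f h) m + fcoef (fps_mul g h) m) !fcoef_mul.
by under eq_bigr do rewrite /= mulrDl; rewrite big_split.
Qed.

Fact fps_mulA : associative fps_mul.
Proof.
move=> f g h; apply: fpsP => m; rewrite !fcoef_mul.
pose F (t : monom * monom * monom) := fcoef f t.1.1 * fcoef g t.1.2 * fcoef h t.2.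
pose s1 := [seq ((p.1, r.1), r.2) | p <- fsplits m, r <- fsplits p.2].
pose s2 := [seq ((r.1, r.2), p.2) | p <- fsplits m, r <- fsplits p.1].
transitivity (\sum_(t <- s1) F t).
  rewrite /s1 big_allpairs_dep; apply: eq_bigr => p _.
  by rewrite fcoef_mul mulr_sumr; apply: eq_bigr => r _; rewrite /F mulrA.
transitivity (\sum_(t <- s2) F t); last first.
  rewrite /s2 big_allpairs_dep; apply: eq_bigr => p _.
  by rewrite fcoef_mul mulr_suml; apply: eq_bigr.
apply: perm_big; apply: uniq_perm.
- apply: allpairs_uniq_dep; rewrite ?fset_uniq //.
    by move=> x _; rewrite fset_uniq.
  move=> t u /allpairsPdep[[a b] [[c d] [_ cd ->]]].
  move=> /allpairsPdep[[a' b'] [[c' d'] [_ cd' ->]]].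
  move: cd cd'; rewrite !mem_fsplits /= => /eqP cd /eqP cd' [aa cc dd].
  by rewrite -cd -cd' aa cc dd.
- apply: allpairs_uniq_dep; rewrite ?fset_uniq //.
    by move=> x _; rewrite fset_uniq.
  move=> t u /allpairsPdep[[a b] [[c d] [_ cd ->]]].
  move=> /allpairsPdep[[a' b'] [[c' d'] [_ cd' ->]]].
  move: cd cd'; rewrite !mem_fsplits /= => /eqP cd /eqP cd' [aa cc dd].
  by rewrite -cd -cd' aa cc dd.
move=> [[a b] c]; apply/allpairsPdep/allpairsPdep.
  move=> [[x y] [[z w] []]]; rewrite !mem_fsplits /=.
  move=> /eqP xy /eqP zw [-> -> ->].
  exists (mmul x z, w), (x, z); rewrite !mem_fsplits /= -mulmA zw xy.
  by rewrite !eqxx.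
move=> [[x y] [[z w] []]]; rewrite !mem_fsplits /=.
move=> /eqP xy /eqP zw [-> -> ->].
exists (z, mmul w y), (w, y); rewrite !mem_fsplits /= mulmA zw xy.
by rewrite !eqxx.
Qed.

Fact fps_one_neq0 : fps_one != 0 :> fps.
Proof.
apply/eqP => /(congr1 (fun f => fcoef f mone)) /=.
by rewrite eqxx => /eqP; rewrite oner_eq0.
Qed.

HB.instance Definition _ := GRing.Zmodule_isComNzRing.Build fps
  fps_mulA fps_mulC fps_mul1 fps_mulDl fps_one_neq0.

Fact fps_scaleA a b f : fps_scale a (fps_scale b f) = fps_scale (a * b) f.
Proof. by apply: fpsP => m /=; rewrite mulrA. Qed.
Fact fps_scale1 : left_id 1 fps_scale.
Proof. by move=> f; apply: fpsP => m /=; rewrite mul1r. Qed.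
Fact fps_scaleDr : right_distributive fps_scale +%R.
Proof. by move=> c f g; apply: fpsP => m /=; rewrite mulrDr. Qed.
Fact fps_scaleDl f : {morph fps_scale^~ f : a b / a + b}.
Proof. by move=> a b; apply: fpsP => m /=; rewrite mulrDl. Qed.

HB.instance Definition _ := GRing.Zmodule_isLmodule.Build R fps
  fps_scaleA fps_scale1 fps_scaleDr fps_scaleDl.

Fact fps_scaleAl (c : R) f g : c *: (f * g) = (c *: f) * g.
Proof.
apply: fpsP => m; rewrite -[RHS]/(fcoef (fps_mul (c *: f) g) m).
rewrite -[LHS]/(c * fcoef (fps_mul f g) m) !fcoef_mul mulr_sumr.
by apply: eq_bigr => p _; rewrite mulrA.
Qed.

HB.instance Definition _ := GRing.Lmodule_isLalgebra.Build R fps fps_scaleAl.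
HB.instance Definition _ := GRing.Lalgebra_isComAlgebra.Build R fps.

End PowerSeries.

Notation fpsQ := (fps rat).

(* (i, true) is the primed letter (i+1)' and (i, false) the letter i+1. *)
Definition letter := (nat * bool)%type.

Definition letter_le (a b : letter) : bool :=
  (a.1 < b.1)%N || (a.1 == b.1) && (b.2 ==> a.2).

Definition row_filling (n : nat) (t : seq letter) : Prop :=
  [/\ size t = n, sorted letter_le t &
      forall i, (count_mem (i, true) t <= 1)%N].

Definition row_fillings (n : nat) (m : monom) : set (seq letter) :=
  [set t | row_filling n t /\
     forall i, m i = (count_mem (i, false) t + count_mem (i, true) t)%N].

Lemma finite_row_fillings n m : finite_set (row_fillings n m).
Proof.
pose X : {fset letter} :=
  seq_fset tt [seq (i, b) | i <- finsupp m, b <- [:: true; false]].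
apply: (sub_finite_set _ (finite_bounded_seq X n)) => t /= [[<- _ _] mt].
split => // -[i b] tib; rewrite seq_fsetE.
apply/allpairsP; exists (i, b); split => //; last by case: b {tib}.
rewrite -cmE_neq0 mt -lt0n addn_gt0 -!has_count !has_pred1.
by case: b tib => ->; rewrite ?orbT.
Qed.

Definition Qrow (n : nat) : fpsQ :=
  Fps (fun m => (#|` fset_set (row_fillings n m)|)%:R).

Definition q (z : int) : fpsQ :=
  match z with
  | Posz 0 => 1
  | Posz n => Qrow n
  | Negz _ => 0
  end.

Inductive Omega : fpsQ -> Prop :=
| Omega_q n : (0 < n)%N -> Omega (q n%:Z)
| Omega_1 : Omega 1
| Omega_sub f g : Omega f -> Omega g -> Omega (f - g)
| Omega_mul f g : Omega f -> Omega g -> Omega (f * g).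

(* Omega is torsion-free and consists of series with integer coefficients, so
   Q (x) Omega is canonically the Q-linear span of Omega in Q[[x_1, x_2, ...]]. *)
Inductive Omega_span : fpsQ -> Prop :=
| Omega_span0 : Omega_span 0
| Omega_spanD (c : rat) f g :
    Omega f -> Omega_span g -> Omega_span (c *: f + g).

Definition QOmega_pred : pred fpsQ := fun f => `[< Omega_span f >].

Lemma Omega_spanP f : reflect (Omega_span f) (f \in QOmega_pred).
Proof. exact: asboolP. Qed.

Lemma Omega_span_add f g : Omega_span f -> Omega_span g -> Omega_span (f + g).
Proof.
move=> sf sg; elim: sf => [|c h k Oh _ IH]; first by rewrite add0r.
by rewrite -addrA; exact: Omega_spanD.
Qed.

Lemma Omega_span_scale c f : Omega_span f -> Omega_span (c *: f).
Proof.
elim=> [|d h k Oh _ IH]; first by rewrite scaler0; exact: Omega_span0.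
by rewrite scalerDr scalerA; exact: Omega_spanD.
Qed.

Lemma Omega_span_incl f : Omega f -> Omega_span f.
Proof.
move=> Of; rewrite -[f]addr0 -[f]scale1r.
by apply: Omega_spanD => //; exact: Omega_span0.
Qed.

Lemma Omega_span_mul f g : Omega_span f -> Omega_span g -> Omega_span (f * g).
Proof.
move=> sf; elim=> [|c h k Oh _ IH]; first by rewrite mulr0; exact: Omega_span0.
rewrite mulrDr; apply: Omega_span_add => //.
elim: sf => [|d u v Ou _ IH']; first by rewrite mul0r; exact: Omega_span0.
rewrite mulrDl; apply: Omega_span_add => //.
rewrite -scalerAl -scalerAr; do 2 apply: Omega_span_scale.
by apply: Omega_span_incl; exact: Omega_mul.
Qed.

Fact QOmega_subalg : GRing.subalg_closed QOmega_pred.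
Proof.
split.
- by apply/Omega_spanP/Omega_span_incl; exact: Omega_1.
- move=> c f g /Omega_spanP sf /Omega_spanP sg; apply/Omega_spanP.
  by apply: Omega_span_add => //; exact: Omega_span_scale.
- by move=> f g /Omega_spanP sf /Omega_spanP sg; exact/Omega_spanP/Omega_span_mul.
Qed.

HB.instance Definition _ :=
  GRing.isSubalgClosed.Build rat fpsQ QOmega_pred QOmega_subalg.

Record QOmega := QOmegaElt { QOmega_val : fpsQ; _ : QOmega_val \in QOmega_pred }.

HB.instance Definition _ := [isSub for QOmega_val].
HB.instance Definition _ := [Choice of QOmega by <:].
HB.instance Definition _ := [SubChoice_isSubComNzRing of QOmega by <:].
HB.instance Definition _ := [SubZmodule_isSubLmodule of QOmega by <:].
HB.instance Definition _ := [SubNzRing_SubLmodule_isSubLalgebra of QOmega by <:].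
HB.instance Definition _ := GRing.Lalgebra_isComAlgebra.Build rat QOmega.

(* The letter k : nat of the free monoid stands for y_(k+1). *)
Notation NC := {malg rat[{fmonom nat}]}.

Definition y (n : nat) : NC := if n is k.+1 then << fmu k >> else 1.

Definition chi (n : nat) : NC := \sum_(r < n.+1) (-1) ^+ r * y r * y (n - r).

Inductive Eulerian_ideal : NC -> Prop :=
| Eulerian_ideal0 : Eulerian_ideal 0
| Eulerian_idealD (m : nat) (a b f : NC) : (0 < m)%N ->
    Eulerian_ideal f -> Eulerian_ideal (a * chi m.*2 * b + f).

Definition Eulerian_pred : pred NC := fun f => `[< Eulerian_ideal f >].

Lemma EulerianP f : reflect (Eulerian_ideal f) (f \in Eulerian_pred).
Proof. exact: asboolP. Qed.

Lemma Eulerian_idealDD f g :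
  Eulerian_ideal f -> Eulerian_ideal g -> Eulerian_ideal (f + g).
Proof.
move=> If Ig; elim: If => [|m a b h m0 _ IH]; first by rewrite add0r.
by rewrite -addrA; exact: Eulerian_idealD.
Qed.

Lemma Eulerian_idealM u v f : Eulerian_ideal f -> Eulerian_ideal (u * f * v).
Proof.
elim=> [|m a b h m0 _ IH]; first by rewrite mulr0 mul0r; exact: Eulerian_ideal0.
by rewrite mulrDr mulrDl !mulrA -mulrA; exact: Eulerian_idealD.
Qed.

Fact Eulerian_zmod : zmod_closed Eulerian_pred.
Proof.
split=> [|f g /EulerianP If /EulerianP Ig]; first exact/EulerianP/Eulerian_ideal0.
apply/EulerianP/Eulerian_idealDD => //.
by rewrite -mulN1r -[_ * g]mulr1; exact: Eulerian_idealM.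
Qed.

HB.instance Definition _ := GRing.isZmodClosed.Build NC Eulerian_pred Eulerian_zmod.

Definition AE := Quotient.quot (GRing.ZmodClosed.clone NC Eulerian_pred _).
HB.instance Definition _ := EqQuotient.on AE.
HB.instance Definition _ := GRing.Zmodule.on AE.

Local Open Scope quotient_scope.

Lemma piAE_eq (f g : NC) : \pi_AE f = \pi_AE g <-> Eulerian_ideal (f - g).
Proof.
split=> [/eqP|/EulerianP].
  by rewrite -Quotient.idealrBE => /EulerianP.
by rewrite Quotient.idealrBE => /eqP.
Qed.

Lemma Eulerian_ideal_aug f : Eulerian_ideal f -> mcoeff mone f = 0.
Proof.
elim=> [|m a b g m0 _ IH]; first by rewrite mcoeff0.
rewrite mcoeffD IH addr0 !rmorphM /=.
suff -> : mcoeff mone (chi m.*2) = 0 by rewrite mulr0 mul0r.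
have y0 n : (0 < n)%N -> mcoeff mone (y n) = 0.
  by case: n => // n _; rewrite /y mcoeffU1 fm1_eq1.
rewrite /chi raddf_sum big1 // => r _; rewrite /= !rmorphM /=.
have [r0|/y0 ->] := posnP r; last by rewrite mulr0 mul0r.
by rewrite (y0 (m.*2 - r)%N) ?mulr0 // r0 subn0 double_gt0.
Qed.

Definition AE_one : AE := \pi_AE 1.
Definition AE_mul : AE -> AE -> AE := lift_op2 AE *%R.
Definition AE_scale (c : rat) : AE -> AE := lift_op1 AE ( *:%R c).

Lemma piAE_repr (f : NC) : Eulerian_ideal (repr (\pi_AE f) - f).
Proof. by apply/piAE_eq; rewrite reprK. Qed.

Lemma piAE_mul f g : AE_mul (\pi_AE f) (\pi_AE g) = \pi_AE (f * g).
Proof.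
unlock AE_mul; apply/piAE_eq; set f' := repr _; set g' := repr _.
have -> : f' * g' - f * g = 1 * (f' - f) * g' + f * (g' - g) * 1.
  by rewrite mul1r mulr1 mulrBl mulrBr addrA subrK.
by apply: Eulerian_idealDD; apply: Eulerian_idealM; exact: piAE_repr.
Qed.

Lemma piAE_scale c f : AE_scale c (\pi_AE f) = \pi_AE (c *: f).
Proof.
unlock AE_scale; apply/piAE_eq; rewrite -scalerBr -[_ - f]mul1r.
rewrite scalerAl -[X in Eulerian_ideal X]mulr1.
by apply: Eulerian_idealM; exact: piAE_repr.
Qed.

Lemma piAE_add (f g : NC) : \pi_AE (f + g) = \pi_AE f + \pi_AE g.
Proof. by rewrite piE. Qed.

Fact AE_mulA : associative AE_mul.
Proof.
by move=> u v w; rewrite -[u]reprK -[v]reprK -[w]reprK !piAE_mul mulrA.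
Qed.
Fact AE_mul1l : left_id AE_one AE_mul.
Proof. by move=> u; rewrite -[u]reprK piAE_mul mul1r. Qed.
Fact AE_mul1r : right_id AE_one AE_mul.
Proof. by move=> u; rewrite -[u]reprK piAE_mul mulr1. Qed.
Fact AE_mulDl : left_distributive AE_mul +%R.
Proof.
move=> u v w; rewrite -[u]reprK -[v]reprK -[w]reprK -piAE_add !piAE_mul.
by rewrite -piAE_add mulrDl.
Qed.
Fact AE_mulDr : right_distributive AE_mul +%R.
Proof.
move=> u v w; rewrite -[u]reprK -[v]reprK -[w]reprK -piAE_add !piAE_mul.
by rewrite -piAE_add mulrDr.
Qed.
Fact AE_one_neq0 : AE_one != 0.
Proof.
apply/eqP; rewrite -[0](reprK 0) => /piAE_eq /Eulerian_ideal_aug.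
have /piAE_eq/Eulerian_ideal_aug : \pi_AE (repr (0 : AE)) = \pi_AE 0.
  by rewrite reprK piE.
by rewrite !mcoeffB mcoeff0 subr0 mcoeff1 eqxx => ->; rewrite subr0.
Qed.

HB.instance Definition _ := GRing.Zmodule_isNzRing.Build AE
  AE_mulA AE_mul1l AE_mul1r AE_mulDl AE_mulDr AE_one_neq0.

Fact AE_scaleA a b u : AE_scale a (AE_scale b u) = AE_scale (a * b) u.
Proof. by rewrite -[u]reprK !piAE_scale scalerA. Qed.
Fact AE_scale1 : left_id 1 AE_scale.
Proof. by move=> u; rewrite -[u]reprK piAE_scale scale1r. Qed.
Fact AE_scaleDr : right_distributive AE_scale +%R.
Proof.
move=> c u v; rewrite -[u]reprK -[v]reprK -piAE_add !piAE_scale.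
by rewrite -piAE_add scalerDr.
Qed.
Fact AE_scaleDl u : {morph AE_scale^~ u : a b / a + b}.
Proof. by move=> a b; rewrite -[u]reprK !piAE_scale -piAE_add scalerDl. Qed.

HB.instance Definition _ := GRing.Zmodule_isLmodule.Build rat AE
  AE_scaleA AE_scale1 AE_scaleDr AE_scaleDl.

Fact AE_scaleAl (c : rat) (u v : AE) : c *: (u * v) = (c *: u) * v.
Proof.
rewrite -[u]reprK -[v]reprK.
rewrite -[LHS]/(AE_scale c (AE_mul _ _)) -[RHS]/(AE_mul (AE_scale c _) _).
by rewrite piAE_scale !piAE_mul piAE_scale scalerAl.
Qed.

HB.instance Definition _ := GRing.Lmodule_isLalgebra.Build rat AE AE_scaleAl.

Lemma NC_scaleAr (c : rat) (f g : NC) : c *: (f * g) = f * (c *: g).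
Proof.
rewrite (malgMEw (fsubset_refl _) (msuppZ_le c g)) malgME scaler_sumr.
apply: eq_bigr => k _; rewrite scaler_sumr; apply: eq_bigr => l _.
by apply/malgP => m; rewrite !mcoeffsE mulrnAr mulrCA.
Qed.

Fact AE_scaleAr (c : rat) (u v : AE) : c *: (u * v) = u * (c *: v).
Proof.
rewrite -[u]reprK -[v]reprK.
rewrite -[LHS]/(AE_scale c (AE_mul _ _)) -[RHS]/(AE_mul _ (AE_scale c _)).
by rewrite piAE_scale !piAE_mul piAE_scale NC_scaleAr.
Qed.

HB.instance Definition _ := GRing.Lalgebra_isAlgebra.Build rat AE AE_scaleAr.

Definition composition (a : seq nat) : bool := all (fun k => 0 < k)%N a.

(* The blocks of s are the runs of adjacent parts of a that are added up. *)
Definition coarsening (b a : seq nat) : Prop :=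
  exists s : seq (seq nat), [/\ [::] \notin s, flatten s = a & map sumn s = b].

Lemma finite_coarsenings a : finite_set [set b | coarsening b a].
Proof.
pose X := seq_fset tt (iota 0 (sumn a).+1).
apply: (sub_finite_set _ (finite_bounded_seq X (size a))).
move=> b [s [s0 def_a <-]] /=; rewrite -{1}def_a; split.
  rewrite size_map; elim: s s0 {def_a} => //= t s IH; rewrite inE negb_or size_cat.
  case/andP; rewrite eq_sym -size_eq0 -lt0n => t0 /IH.
  by move=> /(leq_add t0); rewrite add1n.
move=> _ /mapP[t ts ->]; rewrite seq_fsetE mem_iota /= add0n ltnS.
rewrite -def_a; elim: s ts {s0 def_a} => //= u s IH.
rewrite inE sumn_cat => /predU1P[->|/IH le].
  exact: leq_addr.
exact: leq_trans le (leq_addl _ _).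
Qed.

Definition ycomp (a : seq nat) : NC := \prod_(k <- a) y k.

Definition hcomp (a : seq nat) : NC :=
  (-1) ^+ size a *
    \sum_(b \in [set b | coarsening b a]) (-1) ^+ size b * ycomp b.

(* Rows and columns of a diagram are counted from 0. *)
Definition skew_cell (nu kappa : seq nat) (c : nat * nat) : bool :=
  (nth 0 kappa c.1 <= c.2 < nth 0 nu c.1)%N.

Definition adjacent (c d : nat * nat) : bool :=
  [|| (c.1 == d.1) && (c.2.+1 == d.2), (c.1 == d.1) && (d.2.+1 == c.2),
      (c.2 == d.2) && (c.1.+1 == d.1) | (c.2 == d.2) && (d.1.+1 == c.1)]%N.

Definition skew_shape (nu kappa : seq nat) : Prop :=
  [/\ sorted geq nu, sorted geq kappa, all (ltn 0%N) nu,
      size kappa = size nu & forall i, (nth 0 kappa i <= nth 0 nu i)%N].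

Definition skew_connected (nu kappa : seq nat) : Prop :=
  forall c d, skew_cell nu kappa c -> skew_cell nu kappa d ->
    exists p, [/\ path adjacent c p, all (skew_cell nu kappa) p & last c p = d].

Definition ribbon (nu kappa : seq nat) : Prop :=
  [/\ skew_shape nu kappa, skew_connected nu kappa &
      forall i j, ~~ [&& skew_cell nu kappa (i, j), skew_cell nu kappa (i, j.+1),
                         skew_cell nu kappa (i.+1, j) &
                         skew_cell nu kappa (i.+1, j.+1)]].

Definition row_lengths (nu kappa : seq nat) : seq nat :=
  mkseq (fun i => nth 0 nu i - nth 0 kappa i)%N (size nu).

(* Consecutive rows of a ribbon overlap in exactly one column, so with its
   last row starting in the first column kappa_i = sum_(j > i) (a_j - 1) and
   nu_i = kappa_i + a_i. *)
Definition ribbon_inner (a : seq nat) : seq nat :=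
  mkseq (fun i => \sum_(i.+1 <= j < size a) (nth 0 a j).-1)%N (size a).

Definition ribbon_outer (a : seq nat) : seq nat :=
  mkseq (fun i => nth 0 (ribbon_inner a) i + nth 0 a i)%N (size a).

Section RibbonOfComposition.
Variables nu kappa : seq nat.
Let k := size nu.
Local Notation N := (nth 0%N nu).
Local Notation K := (nth 0%N kappa).
Local Notation cell := (skew_cell nu kappa).

Let reach c d :=
  exists p, [/\ path adjacent c p, all cell p & last c p = d].

Let reach_trans c d e : reach c d -> reach d e -> reach c e.
Proof.
move=> [p [pp cp lp]] [r [pr cr lr]]; exists (p ++ r).
by rewrite cat_path all_cat last_cat lp pp cp pr cr.
Qed.

Let reach1 c d : cell d -> adjacent c d -> reach c d.
Proof. by move=> cd acd; exists [:: d]; rewrite /= cd acd. Qed.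

Let cell_row c : cell c -> (c.1 < k)%N.
Proof.
case/andP=> _ c2; rewrite ltnNge; apply/negP => kc.
by move: c2; rewrite nth_default.
Qed.

Lemma chained_rows_ribbon :
  size kappa = k -> (forall i, (i < k)%N -> (K i < N i)%N) ->
  (forall i, (i.+1 < k)%N -> N i.+1 = (K i).+1) -> ribbon nu kappa.
Proof.
move=> szk KN NK; split; first split => //.
- apply/(sortedP 0%N) => i ik; rewrite /geq /= NK //; exact: KN (ltnW ik).
- apply/(sortedP 0%N) => i; rewrite szk => ik; rewrite /geq /= -ltnS -(NK i) //.
  exact: KN.
- apply/(all_nthP 0%N) => i ik; exact: leq_ltn_trans (leq0n _) (KN i ik).
- move=> i; have [/KN/ltnW//|ki] := ltnP i k.
  by rewrite nth_default ?szk.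
- have cellK i : (i < k)%N -> cell (i, K i).
    by move=> ik; rewrite /skew_cell /= leqnn KN.
  have toK i j : cell (i, j) -> reach (i, j) (i, K i) /\ reach (i, K i) (i, j).
    elim: j => [|j IH] cij.
      move: (cij) => /andP[/=]; rewrite leqn0 => /eqP -> _.
      by split; exists [::].
    move: (cij) => /andP[/=]; rewrite leq_eqVlt => /predU1P[-> _|].
      by split; exists [::].
    rewrite ltnS => Kj jN.
    have cj : cell (i, j) by rewrite /skew_cell /= Kj ltnW.
    have [r1 r2] := IH cj; split.
      by apply: reach_trans r1; apply: reach1; rewrite // /adjacent /= !eqxx orbT.
    by apply: reach_trans r2 _; apply: reach1; rewrite // /adjacent /= !eqxx.
  have to0 i : (i < k)%N -> reach (i, K i) (0, K 0)%N /\ reach (0, K 0)%N (i, K i).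
    elim: i => [|i IH] ik; first by split; exists [::].
    have [r1 r2] := IH (ltnW ik).
    have ci : cell (i.+1, K i).
      by rewrite /skew_cell /= NK // leqnn andbT -ltnS -(NK i) // KN.
    have [s1 s2] := toK _ _ ci; split.
      apply: reach_trans s2 _; apply: reach_trans r1.
      by apply: reach1; [exact: cellK (ltnW ik) | rewrite /adjacent /= !eqxx !orbT].
    apply: reach_trans r2 _; apply: reach_trans s1.
    by apply: reach1; rewrite // /adjacent /= !eqxx !orbT.
  move=> [i j] [i' j'] cc cd.
  have [c1 _] := toK _ _ cc; have [_ d2] := toK _ _ cd.
  have [c3 _] := to0 _ (cell_row cc); have [_ d4] := to0 _ (cell_row cd).
  by apply: reach_trans c1 _; apply: reach_trans c3 _; exact: reach_trans d4 _.
- move=> i j; apply/negP => /and4P[/andP[/= Kj _] _ _ cd].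
  have := cell_row cd => /= ik; move: cd => /andP[_ /=].
  by rewrite NK // ltnS ltnNge Kj.
Qed.

Lemma ribbon_chained_rows : ribbon nu kappa ->
  (forall i, (i < k)%N -> (K i < N i)%N) ->
  forall i, (i.+1 < k)%N -> N i.+1 = (K i).+1.
Proof.
move=> [[sN sK _ szk _] conn no22] KN i ik.
have NN : (N i.+1 <= N i)%N by move/(sortedP 0%N): sN => /(_ _ ik).
have KK : (K i.+1 <= K i)%N.
  by move/(sortedP 0%N): sK => /(_ i); rewrite szk => /(_ ik).
apply/eqP; rewrite eqn_leq; apply/andP; split.
  rewrite leqNgt; apply/negP => KN2; move: (no22 i (K i)).
  rewrite /skew_cell /= leqnn leqnSn KN ?(ltnW ik) //= (leq_trans KN2 NN) /=.
  by rewrite KK (ltnW KN2) KN2 (leq_trans KK (leqnSn _)).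
have c1 : cell (i, K i) by rewrite /skew_cell /= leqnn KN // ltnW.
have c2 : cell (i.+1, K i.+1) by rewrite /skew_cell /= leqnn KN.
have [p [pp cp lp]] := conn _ _ c1 c2.
have : ((i, K i).1 <= i)%N by [].
have : (i < (last (i, K i) p).1)%N by rewrite lp.
elim: p (i, K i) c1 pp cp {lp} => [|d p IH] c c1 /=.
  by move=> _ _ /leq_trans/[apply]; rewrite ltnn.
move=> /andP[acd pp] /andP[cd cp] lt_i le_i.
have [|id] := leqP d.1 i; first exact: IH.
move: acd id le_i c1 cd; case: c d {IH pp lt_i} => [r s] [r' s'] /=.
rewrite /adjacent /skew_cell /=.
case/or4P => /andP[/eqP e /eqP e'].
- by rewrite e ltnNge => /negP.
- by rewrite e ltnNge => /negP.
- rewrite -e' e ltnS => ir ri; have -> : r = i by apply/eqP; rewrite eqn_leq ir ri.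
  by move=> /andP[+ _] /andP[_]; exact: leq_ltn_trans.
by rewrite -e' => ir /(ltn_trans ir); rewrite ltnn.
Qed.

End RibbonOfComposition.

Lemma ribbon_innerE a i : (i < size a)%N ->
  nth 0%N (ribbon_inner a) i = (\sum_(i.+1 <= j < size a) (nth 0 a j).-1)%N.
Proof. by move=> ia; rewrite nth_mkseq. Qed.

Lemma ribbon_of_composition a : composition a ->
  ribbon (ribbon_outer a) (ribbon_inner a) /\
  row_lengths (ribbon_outer a) (ribbon_inner a) = a.
Proof.
move=> /(all_nthP 0%N) a_gt0; split.
  apply: chained_rows_ribbon; rewrite !size_mkseq // => i ia.
    by rewrite [ltnRHS]nth_mkseq // -[ltnLHS]addn0 ltn_add2l a_gt0.
  rewrite nth_mkseq // !ribbon_innerE //; last exact: ltnW.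
  by rewrite [in RHS]big_ltn // -addSn prednK ?a_gt0 // addnC.
apply: (@eq_from_nth _ 0%N) => [|i]; rewrite !size_mkseq // => ia.
by rewrite nth_mkseq ?size_mkseq // nth_mkseq // addKn.
Qed.

Lemma ribbon_composition_unique nu kappa : ribbon nu kappa ->
  composition (row_lengths nu kappa) -> last 0%N kappa = 0%N ->
  nu = ribbon_outer (row_lengths nu kappa) /\
  kappa = ribbon_inner (row_lengths nu kappa).
Proof.
move=> rib /(all_nthP 0%N); set a := row_lengths _ _ => a_gt0 last0.
have [[_ _ _ szk le_kn] _ _] := rib.
have sza : size a = size nu by rewrite size_mkseq.
have aE i : (i < size nu)%N -> nth 0%N a i = (nth 0 nu i - nth 0 kappa i)%N.
  by move=> ik; rewrite nth_mkseq.
have KN i : (i < size nu)%N -> (nth 0 kappa i < nth 0 nu i)%N.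
  by move=> ik; rewrite -subn_gt0 -aE // a_gt0 // sza.
have NK := ribbon_chained_rows rib KN.
have kE : kappa = ribbon_inner a.
  apply: (@eq_from_nth _ 0%N); rewrite ?size_mkseq ?szk ?sza // => i ik.
  rewrite ribbon_innerE ?sza //.
  have [n] := ubnP (size nu - i)%N; elim: n i ik => // n IH i ik.
  rewrite ltnS => le_n; have [ik1|] := ltnP i.+1 (size nu); last first.
    move=> le_k; rewrite big_geq //.
    have -> : i = (size kappa).-1.
      apply/eqP; rewrite szk eqn_leq -ltnS prednK ?ik ?(leq_trans _ ik) //=.
      by rewrite -ltnS prednK ?(leq_trans _ ik).
    by rewrite nth_last.
  rewrite big_ltn // -IH //; last by rewrite subnS prednK ?subn_gt0.
  rewrite aE // NK // subSn; last by rewrite -ltnS -(NK i) // KN.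
  by rewrite /= subnK // -ltnS -(NK i) // KN.
split => //; apply: (@eq_from_nth _ 0%N); rewrite ?size_mkseq ?sza // => i ik.
by rewrite [RHS]nth_mkseq ?sza // -kE aE // subnKC.
Qed.

Definition skew_det (nu kappa : seq nat) : fpsQ :=
  \det (\matrix_(i < size nu, j < size nu)
    q ((nth 0%N nu i)%:Z - (nth 0%N kappa j)%:Z - i%:Z + j%:Z)).

Definition ribbonQ (a : seq nat) : fpsQ :=
  skew_det (ribbon_outer a) (ribbon_inner a).

(* Main.v *)
Require Import Defs.
From HB Require Import structures.
From mathcomp Require Import all_boot all_order all_algebra.
From mathcomp Require Import zify ring finmap.
From mathcomp.multinomials Require Import monalg.
From mathcomp Require Import boolp classical_sets functions cardinality fsbigop.

Set Implicit Arguments.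
Unset Strict Implicit.
Unset Printing Implicit Defensive.

Import GRing.Theory.
Local Open Scope ring_scope.
Local Open Scope quotient_scope.

(** A row filling of content m is determined by the set of indices that occur
primed, an arbitrary subset of the support of m; hence the coefficient of m in
q_n is 2^|supp m| if m has degree n, and 0 otherwise. The coefficient of m in
sum_r (-1)^r q_r q_(n-r) then factors over the variables, and the factor of a
variable of exponent k > 0 is 2 - 4 + 4 - ... + (-1)^k 2 = 0. So y_i |-> q_i kills
every chi_(2m) and factors through A_E.

Both h_a (in any algebra) and the ribbon determinant satisfy
F(x, z, s) = q_x F(z, s) - F(x + z, s): for h_a, split the coarsenings according
to whether x stays a part or is merged with z; for the determinant, expand
along the first column (q_x, 1, 0, ..., 0). *)

(** * The relations between the q_n *)

Lemma letter_le_trans : transitive letter_le.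
Proof.
move=> [j b] [i a] [k c]; rewrite /letter_le /= => /orP[ij|/andP[/eqP-> ba]].
  by move=> /orP[/(ltn_trans ij)->//|/andP[/eqP<- _]]; rewrite ij.
by move=> /orP[->//|/andP[-> cb]]; rewrite orbC; case: a b c ba cb => [] [] [].
Qed.

Lemma letter_le_total : total letter_le.
Proof.
by move=> [i a] [j b]; rewrite /letter_le /=; case: ltngtP => //= _; case: a b => [] [].
Qed.

Lemma letter_le_anti : antisymmetric letter_le.
Proof.
move=> [i a] [j b]; rewrite /letter_le /=; case: ltngtP => //= ->.
by case: a b => [] [].
Qed.

Definition content (t : seq letter) : monom :=
  \big[mmul/mone]_(x <- t) ucm x.1.

Lemma contentE t i :
  content t i = (count_mem (i, false) t + count_mem (i, true) t)%N.
Proof.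
elim: t => [|[j b] t IH]; first by rewrite /content big_nil cm1.
rewrite /content big_cons cmM cmU -/(content t) IH /= !xpair_eqE.
by case: b; case: eqP => _ /=; rewrite ?addnA // -?addnA addnCA.
Qed.

Lemma mdeg_content t : mdeg (content t) = size t.
Proof.
by rewrite mdeg_prod (eq_bigr (fun=> 1%N)) ?sum1_size // => x _; exact: mdegU.
Qed.

(** * Row fillings of a given content and the coefficients of q_n *)

Section Filling.
Variable m : monom.
Implicit Type P : {fset nat}.

Definition letter_block P i : seq letter :=
  nseq (i \in P) (i, true) ++ nseq (m i - (i \in P)) (i, false).

(* [P] is the set of the indices that occur primed. *)
Definition filling P : seq letter :=
  sort letter_le (flatten [seq letter_block P i | i <- finsupp m]).

(** Letters of index i occur only in the block of i, and sorting does not change multiplicities. *)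
Lemma count_filling P i b : (P `<=` finsupp m)%fset ->
  count_mem (i, b) (filling P) = if b then i \in P : nat else (m i - (i \in P))%N.
Proof.
move=> PS; rewrite /filling count_sort count_flatten sumnE !big_map.
have cb j : count_mem (i, b) (letter_block P j) =
    if i == j then if b then i \in P : nat else (m i - (i \in P))%N else 0%N.
  rewrite count_cat !count_nseq /= !xpair_eqE eq_sym.
  by case: eqP => [->|_]; case: b; rewrite ?mul1n ?mul0n ?addn0.
under eq_bigr do rewrite cb.
rewrite -big_mkcond /=; have [iS|iS] := boolP (i \in finsupp m).
  rewrite (big_rem i) //= eqxx big_seq_cond big1 ?addn0 // => j.
  by rewrite mem_rem_uniq ?fset_uniq // inE => /andP[/andP[/negPf ji _]]; rewrite eq_sym ji.
rewrite big_seq_cond big1 => [|j /andP[jS /eqP ij]]; last by rewrite ij jS in iS.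
(* With i outside the support there is no block for i, and both expected counts are 0. *)
have -> : i \in P = false by apply: contraNF iS; exact/fsubsetP.
by move: iS; rewrite -cmE_eq0 => /eqP->; rewrite if_same.
Qed.

Lemma content_filling P : (P `<=` finsupp m)%fset -> content (filling P) = m.
Proof.
move=> PS; apply/eqP/cmP => i; rewrite contentE !count_filling // subnK //.
(* The truncated subtraction is exact: an index in [P] has positive exponent. *)
by have [/(fsubsetP PS)|//] := boolP (i \in P); rewrite -cmE_neq0 lt0n.
Qed.

(** The multiplicities of the primed letters are the indicator function of [P]. *)
Lemma filling_inj : {in fpowerset (finsupp m) &, injective filling}.
Proof.
move=> P P'; rewrite !fpowersetE => PS PS' e; apply/fsetP => i.
have := count_filling i true PS; rewrite e (count_filling i true PS').
by case: (_ \in P) (_ \in P') => [] [].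
Qed.

(** A word sorted for the total order [letter_le] is determined by its multiplicities. Since a
    primed letter occurs at most once, these are fixed by m and the set of primed indices. *)
Lemma row_fillingsE n : row_fillings n m =
  [set filling P | P in [set P | (P `<=` finsupp m)%fset /\ mdeg m = n]]%classic.
Proof.
apply/seteqP; split=> [t [[<- st prim] mt]|_ [P [PS <-]] <-].
  have mE : m = content t by apply/eqP/cmP => i; rewrite mt contentE.
  pose P := [fset i in finsupp m | (i, true) \in t]%fset.
  have PS : (P `<=` finsupp m)%fset by exact: fset_sub.
  exists P; first by split=> //; rewrite mE mdeg_content.
  apply: (sorted_eq letter_le_trans letter_le_anti _ st).
    exact: sort_sorted letter_le_total _.
  have PE i : (i \in P) = count_mem (i, true) t :> nat.
    have := prim i; rewrite !inE -cmE_neq0 mt -has_pred1 has_count /=.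
    by case: (count _ t) => [|[|]] //; rewrite ?andbF // addn1.
  apply/allP => -[i b] _ /=; rewrite count_filling // PE mt.
  by case: b => //; rewrite addnK.
split; first split.
- by rewrite -mdeg_content content_filling.
- exact: sort_sorted letter_le_total _.
- by move=> i; rewrite count_filling //; case: (_ \in P).
by move=> i; rewrite -contentE content_filling.
Qed.

Lemma fcoef_Qrow n :
  fcoef (Qrow n) m = (mdeg m == n)%:R * 2%:R ^+ #|` finsupp m|.
Proof.
rewrite /= row_fillingsE; have [dn|dn] := eqVneq (mdeg m) n; last first.
  rewrite (_ : mkset _ = set0) ?image_set0 ?fset_set0 ?cardfs0 ?mul0r //.
  by apply/seteqP; split=> // P [_ /eqP]; rewrite (negPf dn).
rewrite mul1r -natrX -card_fpowerset -(card_in_imfset imfset_key filling_inj) /=.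
congr (_%:R); congr #|` _|; apply/fsetP => t.
rewrite in_fset_set; last first.
  by rewrite -row_fillingsE; exact: finite_row_fillings.
apply/idP/imfsetP => [|[P]] /=; rewrite inE => /=.
  by move=> [P [PS _] <-]; exists P; rewrite // fpowersetE.
by rewrite fpowersetE => PS ->; exists P.
Qed.

End Filling.

(** The case n = 0 is separate because [q 0] is 1 by definition; the only monomial of degree 0 has
    empty support. *)
Lemma fcoef_q n m :
  fcoef (q n%:Z) m = (mdeg m == n)%:R * 2%:R ^+ #|` finsupp m|.
Proof.
case: n => [|n]; last exact: fcoef_Qrow.
rewrite mdeg_eq0 /=; case: eqP => [->|_]; last by rewrite mul0r.
have -> : finsupp (mone : monom) = fset0.
  by apply/fsetP => i; rewrite -cmE_neq0 cm1 inE.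
by rewrite cardfs0 mulr1.
Qed.

(** * Splitting off one variable *)

Section VariableSplit.
Variable i : nat.
Implicit Types d e m : monom.

Definition xpow (a : nat) : monom := [cmonom a | _ in [fset i]%fset]%M.
Definition strip (d : monom) : monom := [cmonom d j | j in (finsupp d `\ i)%fset]%M.

Lemma xpowE a j : xpow a j = if j == i then a else 0%N.
Proof. by rewrite cmE fsfunE inE. Qed.

Lemma stripE d j : strip d j = if j == i then 0%N else d j.
Proof.
rewrite cmE fsfunE !inE; case: (j == i) => //=.
by case: ifPn => //; rewrite -cmE_eq0 => /eqP->.
Qed.

Lemma strip_mul d e : strip (mmul d e) = mmul (strip d) (strip e).
Proof. by apply/eqP/cmP => j; rewrite !(stripE, cmM); case: ifP. Qed.

Lemma xpow_strip d : mmul (xpow (d i)) (strip d) = d.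
Proof.
apply/eqP/cmP => j; rewrite cmM xpowE stripE.
by case: eqP => [->|_]; rewrite ?addn0.
Qed.

Lemma xpowD a b : mmul (xpow a) (xpow b) = xpow (a + b).
Proof. by apply/eqP/cmP => j; rewrite cmM !xpowE; case: ifP. Qed.

Lemma mdeg_xpow a : mdeg (xpow a) = a.
Proof.
rewrite (mdegEw (d := [fset i]%fset)) ?big_seq_fset1 ?xpowE ?eqxx //.
apply/fsubsetP => j; rewrite -cmE_neq0 xpowE inE.
by case: (j == i).
Qed.

(** This makes 2^|supp| multiplicative over the variables: the split variable contributes a factor 2
    exactly when its exponent is nonzero. *)
Lemma card_finsupp_xpow a d : d i = 0%N ->
  #|` finsupp (mmul (xpow a) d)| = ((a != 0) + #|` finsupp d|)%N.
Proof.
move=> di0; have [->|a0] := eqVneq a 0%N.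
  by congr #|` _|; apply/fsetP => j; rewrite -!cmE_neq0 cmM xpowE if_same.
have -> : finsupp (mmul (xpow a) d) = (i |` finsupp d)%fset.
  apply/fsetP => j; rewrite !inE -!cmE_neq0 cmM xpowE.
  by case: (j == i); rewrite ?addn_eq0 ?(negPf a0).
by rewrite cardfsU1 -cmE_neq0 di0.
Qed.

(* A splitting of m is a splitting of the other variables together with a
   splitting of the exponent of x_(i+1). *)
Lemma fsplits_xpow m : perm_eq (fsplits m)
  [seq (mmul (xpow a) p.1, mmul (xpow (m i - a)) p.2)
     | p <- fsplits (strip m), a <- iota 0 (m i).+1].
Proof.
have strip0 p : p \in fsplits (strip m) -> p.1 i = 0%N /\ p.2 i = 0%N.
  rewrite mem_fsplits => /eqP/(congr1 (fun d : monom => d i)).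
  by rewrite cmM stripE eqxx => /eqP; rewrite addn_eq0 => /andP[/eqP-> /eqP->].
have stripK a d : d i = 0%N -> strip (mmul (xpow a) d) = d.
  move=> di; apply/eqP/cmP => j; rewrite stripE cmM xpowE.
  by case: eqP => [->|].
apply: uniq_perm; first exact: fset_uniq.
  apply: allpairs_uniq; rewrite ?fset_uniq ?iota_uniq //.
  move=> t u /allpairsP[[[d e] a] [pd _ ->]].
  move=> /allpairsP[[[d' e'] a'] [pd' _ ->]].
  have [/= d0 e0] := strip0 _ pd; have [/= d0' e0'] := strip0 _ pd'.
  move=> /= [e1 e2].
  (* The exponent at [i] of the first component recovers [a]; stripping both components recovers the
     rest. *)
  have := congr1 (fun d : monom => d i) e1; rewrite !cmM !xpowE eqxx d0 d0' !addn0.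
  move=> aa; move/(congr1 strip): e1; move/(congr1 strip): e2.
  by rewrite !stripK // => -> ->; rewrite aa.
move=> [d e]; rewrite mem_fsplits; apply/eqP/allpairsP => [de|]; last first.
  move=> [[[d' e'] a] []]; rewrite mem_fsplits mem_iota /= add0n ltnS.
  move=> /eqP de am [-> ->].
  by rewrite /= [LHS]Monoid.mulmACA /= xpowD subnKC // de xpow_strip.
exists ((strip d, strip e), d i); split.
- by rewrite mem_fsplits /= -strip_mul de.
- by rewrite mem_iota /= add0n ltnS -de cmM leq_addr.
- by rewrite /= -de cmM addKn !xpow_strip.
Qed.

End VariableSplit.

(** * Alternating sums over splittings *)

Lemma sum_sign (R : pzRingType) n : \sum_(a < n) (-1) ^+ a = (odd n)%:R :> R.
Proof.
elim: n => [|n IH]; first by rewrite big_ord0.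
by rewrite big_ord_recr /= IH -signr_odd; case: (odd n); rewrite ?subrr ?add0r.
Qed.

Lemma sum_sign_weights (R : comPzRingType) k : (0 < k)%N ->
  \sum_(a <- iota 0 k.+1)
     (-1) ^+ a * (2%:R ^+ (a != 0%N) * 2%:R ^+ (k - a != 0)%N) = 0 :> R.
Proof.
case: k => // k _; rewrite -[iota _ _]/(index_iota 0 k.+2) big_mkord.
(* The exponent is now k + 1. The end terms are 2 and 2(-1)^(k+1); the k inner terms, of weight 4,
   sum to -4 for odd k and to 0 for even k. *)
rewrite big_ord_recl big_ord_recr /= subnn.
under eq_bigr => a _ do
  rewrite /bump /= add1n subSS -lt0n subn_gt0 ltn_ord exprS mulN1r mulNr.
rewrite sumrN -mulr_suml sum_sign /bump /= add1n (exprS (-1) k) -(signr_odd _ k).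
by case: (odd k); rewrite /= ?expr1 ?expr0; ring.
Qed.

(** By [fcoef_q], the coefficient of d in q_n for n the degree of d. *)
Definition wt (R : pzRingType) (d : monom) : R := 2%:R ^+ #|` finsupp d|.

(** As m is not 1, some variable has positive exponent. Summing first over the splittings of that
    exponent produces the vanishing factor [sum_sign_weights]. *)
Lemma sum_sign_splits (R : comPzRingType) m : m != mone ->
  \sum_(p <- fsplits m) (-1) ^+ mdeg p.1 * (wt R p.1 * wt R p.2) = 0.
Proof.
move=> m1; have [i mi0] : exists i, (0 < m i)%N.
  apply/not_existsP => m0; case/negP: m1; apply/cmP => i; rewrite cm1.
  by apply/eqP; rewrite -leqn0 leqNgt; exact/negP/m0.
rewrite (perm_big _ (fsplits_xpow i m)) big_allpairs_dep /=.
rewrite big_seq big1 // => -[d e]; rewrite mem_fsplits => /eqP/= de.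
have /eqP : (d i + e i = 0)%N by rewrite -cmM de stripE eqxx.
rewrite addn_eq0 => /andP[/eqP d0 /eqP e0].
transitivity ((-1) ^+ mdeg d * (wt R d * wt R e) * \sum_(a <- iota 0 (m i).+1)
    (-1) ^+ a * (2%:R ^+ (a != 0%N) * 2%:R ^+ (m i - a != 0)%N)).
  rewrite mulr_sumr; apply: eq_bigr => a _.
  rewrite /wt !card_finsupp_xpow // mdegM mdeg_xpow !exprD.
  by rewrite [X in _ * X = _]mulrACA [LHS]mulrACA mulrC.
by rewrite sum_sign_weights ?mulr0.
Qed.

Lemma fcoef_sum (I : Type) (r : seq I) (F : I -> fpsQ) m :
  fcoef (\sum_(i <- r) F i) m = \sum_(i <- r) fcoef (F i) m.
Proof. exact: (big_morph (fun f : fpsQ => fcoef f m)). Qed.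

Lemma fcoef_signM r (f g : fpsQ) m : fcoef ((-1) ^+ r * f * g) m =
  \sum_(p <- fsplits m) (-1) ^+ r * (fcoef f p.1 * fcoef g p.2).
Proof.
have -> : (-1) ^+ r * f * g = (-1) ^+ r *: (f * g).
  by rewrite -mulr_algl -in_algE rmorph_sign mulrA.
by rewrite -mulr_sumr -fcoef_mul.
Qed.

(** By homogeneity a splitting (d, e) of m contributes only to r = deg d, and only if m has degree
    n. The double sum thus collapses to [sum_sign_splits]. *)
Lemma q_rel n : (0 < n)%N ->
  \sum_(r < n.+1) (-1) ^+ r * q r%:Z * q (n - r)%N%:Z = 0.
Proof.
move=> n0; apply: fpsP => m; rewrite fcoef_sum.
under eq_bigr do rewrite fcoef_signM.
rewrite exchange_big /=; have [mn|mn] := eqVneq (mdeg m) n; last first.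
  rewrite big_seq big1 // => -[d e]; rewrite mem_fsplits => /eqP/= de.
  rewrite big1 // => r _; rewrite !fcoef_q.
  case: eqP => [dr|_]; last by rewrite mul0r mul0r mulr0.
  case: eqP => [er|_]; last by rewrite mul0r !mulr0.
  by case/eqP: mn; rewrite -de mdegM dr er subnKC // -ltnS.
rewrite -[RHS](@sum_sign_splits rat m) -?mdeg_eq0 ?mn -?lt0n //.
apply: eq_big_seq => -[d e]; rewrite mem_fsplits => /eqP/= de.
have dn : (mdeg d < n.+1)%N by rewrite ltnS -mn -de mdegM leq_addr.
rewrite (bigD1 (Ordinal dn)) //= big1 ?addr0 => [|r rd]; rewrite !fcoef_q.
  by rewrite -mn -de mdegM addKn !eqxx !mul1r.
by rewrite -(inj_eq val_inj) eq_sym /= in rd; rewrite (negPf rd) !mul0r mulr0.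
Qed.

(** * Coarsenings and ribbons *)

Section Coarsenings.
Local Open Scope classical_set_scope.

Lemma mulr_fsumr_finite (R : pzRingType) (I : choiceType) (x : R) (D : set I)
    (F : I -> R) : finite_set D ->
  x * (\sum_(i \in D) F i) = \sum_(i \in D) x * F i.
Proof. by move=> finD; rewrite !fsbig_finite // mulr_sumr. Qed.

Lemma coarsening_nil : [set b | coarsening b [::]] = [set [::]].
Proof.
apply/seteqP; split=> [b [s [s0 fs <-]]|b ->]; last by exists [::].
by case: s s0 fs => // [[|x t] s].
Qed.

Lemma coarsening_seq1 x : [set b | coarsening b [:: x]] = [set [:: x]].
Proof.
apply/seteqP; split=> [b [s [s0 fs <-]]|b ->] /=; last first.
  by exists [:: [:: x]]; split=> //=; rewrite addn0.
case: s s0 fs => [|[|z t] s] //=; rewrite inE => /= s0 [->].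
by case: t s s0 => [|? ?] [|[|? ?] ?] //=; rewrite addn0.
Qed.

(** The first block is either [[:: x]], which can be removed, or begins with x and z, which can be
    fused without changing the block sum. *)
Lemma coarsening_cons2 x z s :
  [set b | coarsening b [:: x, z & s]] =
  [set x :: b | b in [set b | coarsening b (z :: s)]] `|`
  [set b | coarsening b (x + z :: s)%N].
Proof.
apply/seteqP; split=> [b [bs [bs0 fbs <-]]|b [[c [bs [bs0 fbs <-]]] <-|]] /=.
- case: bs bs0 fbs => [|[|x' [|z' t]] bs] //=; rewrite inE => /= bs0 [->].
    move=> fbs; left; exists (map sumn bs); last by rewrite addn0.
    by exists bs.
  move=> -> <-; right; exists ((x + z :: t)%N :: bs).
  by split=> //=; rewrite addnA.
- exists ([:: x] :: bs); split; first by rewrite inE.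
    by rewrite /= fbs.
  by rewrite /= addn0.
- move=> [[|[|x' t] bs] [bs0 fbs <-]] //; case: fbs => -> fbs.
  exists ([:: x, z & t] :: bs); split; first by rewrite inE in bs0 *.
    by rewrite /= fbs.
  by rewrite /= addnA.
Qed.

(** The union is disjoint: the first part is x on one side and at least x + z > x on the other. *)
Lemma fsum_coarsening_cons2 (V : nmodType) (F : seq nat -> V) x z s :
  (0 < z)%N ->
  \sum_(b \in [set b | coarsening b [:: x, z & s]]) F b =
  \sum_(b \in [set b | coarsening b (z :: s)]) F (x :: b) +
  \sum_(b \in [set b | coarsening b (x + z :: s)%N]) F b.
Proof.
move=> z0; rewrite coarsening_cons2 fsbigU0; first last.
- move=> b [[c _ <-]] [[|[|x' t] bs] [bs0 fbs]] //= [].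
  case: fbs => -> _ /eqP.
  by rewrite -addnA -[X in _ == X]addn0 eqn_add2l addn_eq0 gtn_eqF.
- exact: finite_coarsenings.
- exact/finite_image/finite_coarsenings.
by rewrite fsbig_image // => b c _ _ [].
Qed.

Section FlagH.
Variables (R : pzRingType) (Y : nat -> R).

(** [hcomp] is the case [Y := y]. The ring need not be commutative, as the y_i do not commute. *)
Definition flag_h (a : seq nat) : R :=
  (-1) ^+ size a *
    \sum_(b \in [set b | coarsening b a]) (-1) ^+ size b * \prod_(k <- b) Y k.

Lemma flag_h_nil : flag_h [::] = 1.
Proof. by rewrite /flag_h coarsening_nil fsbig_set1 big_nil !mul1r. Qed.

Lemma flag_h_seq1 x : flag_h [:: x] = Y x.
Proof.
by rewrite /flag_h coarsening_seq1 fsbig_set1 big_seq1 expr1 !mulN1r opprK.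
Qed.

(** Keeping x lengthens both the composition and its coarsening, so the signs cancel; merging x with
    z shortens only the composition, whence the minus sign. *)
Lemma flag_h_cons2 x z s : (0 < z)%N ->
  flag_h [:: x, z & s] = Y x * flag_h (z :: s) - flag_h (x + z :: s)%N.
Proof.
move=> z0; rewrite /flag_h fsum_coarsening_cons2 //.
rewrite (_ : \sum_(_ \in [set _ | coarsening _ (z :: s)]) _ =
  - Y x * (\sum_(b \in [set b | coarsening b (z :: s)])
            (-1) ^+ size b * \prod_(k <- b) Y k)); last first.
  rewrite mulr_fsumr_finite; last exact: finite_coarsenings.
  apply: eq_fsbigr => b _; rewrite big_cons /= exprS mulN1r !mulNr.
  by rewrite !mulrA (commr_sign (Y x)).
rewrite mulrDr /= !exprS !mulN1r !mulNr !mulrN !opprK; congr (- _ + _).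
by rewrite !mulrA (commr_sign (Y x)).
Qed.

End FlagH.

End Coarsenings.

(* The index nu_i - kappa_j - i + j of a ribbon telescopes to
   (a_i + a_(i+1) + ...) - (a_(j+1) + a_(j+2) + ...). *)
Definition ribbon_mx (a : seq nat) : 'M[fpsQ]_(size a) :=
  \matrix_(i, j) q ((sumn (drop i a))%:Z - (sumn (drop j.+1 a))%:Z).

(** Parts are positive, so adding back 1 for each later row turns the sum of the a_j - 1 into the
    sum of the a_j. *)
Lemma ribbon_inner_sumn a i : composition a -> (i < size a)%N ->
  (nth 0 (ribbon_inner a) i + (size a - i.+1) = sumn (drop i.+1 a))%N.
Proof.
move=> ca ia; rewrite ribbon_innerE //.
have /(all_nthP 0%N) ap := ca.
rewrite sumnE [in RHS](big_nth 0%N) size_drop.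
rewrite -{1}[i.+1]add0n big_addn !big_mkord -[X in (_ + X)%N]card_ord.
rewrite -sum1_card -big_split /=; apply: eq_bigr => j _.
rewrite nth_drop addn1 addnC prednK //; apply: ap.
by rewrite -ltn_subRL.
Qed.

Lemma ribbonQ_det a : composition a -> ribbonQ a = \det (ribbon_mx a).
Proof.
move=> ca; rewrite /ribbonQ /skew_det size_mkseq; congr (\det _).
apply/matrixP => i j; rewrite !mxE; congr q.
rewrite nth_mkseq // -(ribbon_inner_sumn ca (ltn_ord j)).
rewrite (drop_nth 0%N (ltn_ord i)) /= -(ribbon_inner_sumn ca (ltn_ord i)).
(* The row counts [size a - i.+1] and [size a - j.+1] cancel against -i + j. *)
by have := ltn_ord i; have := ltn_ord j; lia.
Qed.

Lemma ribbonQ_nil : ribbonQ [::] = 1.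
Proof. by rewrite ribbonQ_det // det_mx00. Qed.

Lemma ribbonQ_seq1 x : (0 < x)%N -> ribbonQ [:: x] = q x%:Z.
Proof.
move=> x0; have c : composition [:: x] by rewrite /= x0.
rewrite ribbonQ_det // det_mx11 mxE; congr q.
by rewrite /= addn0 subr0.
Qed.

Lemma det_col0_two (R : comPzRingType) n (M : 'M[R]_n.+2) :
  M (lift ord0 ord0) ord0 = 1 ->
  (forall i : 'I_n, M (lift ord0 (lift ord0 i)) ord0 = 0) ->
  \det M = M ord0 ord0 * \det (row' ord0 (col' ord0 M)) -
    \det (row' (lift ord0 ord0) (col' ord0 M)).
Proof.
move=> M1 M0; rewrite (expand_det_col _ ord0) !big_ord_recl big1 ?addr0 => [|i _].
  by rewrite M1 /cofactor /= !mul1r expr1 mulN1r.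
by rewrite M0 mul0r.
Qed.

(** Deleting row 0 leaves the suffix sums of [z :: s]. Deleting row 1 instead removes the suffix
    starting at z, which is the effect of merging x with z. *)
Lemma ribbonQ_cons2 x z s : composition [:: x, z & s] ->
  ribbonQ [:: x, z & s] = q x%:Z * ribbonQ (z :: s) - ribbonQ (x + z :: s)%N.
Proof.
move=> c; have /and3P[x0 z0 cs] := c.
have c1 : composition (z :: s) by rewrite /= z0.
have c2 : composition (x + z :: s)%N by rewrite /= addn_gt0 x0.
have M00 : ribbon_mx [:: x, z & s] ord0 ord0 = q x%:Z.
  by rewrite mxE; congr q; rewrite /=; lia.
have M10 : ribbon_mx [:: x, z & s] (lift ord0 ord0) ord0 = 1.
  by rewrite mxE subrr.
have Mi0 (i : 'I_(size s)) : ribbon_mx [:: x, z & s] (lift ord0 (lift ord0 i)) ord0 = 0.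
  (* The index is -(z + [sumn (take i s)]), negative because z > 0; [Negz n] is -(n + 1), hence the
     predecessor. *)
  rewrite mxE (_ : _ - _ = Negz (z + sumn (take i s)).-1) //=.
  by have := congr1 sumn (cat_take_drop i s); rewrite add0n sumn_cat; lia.
have minor0 : row' ord0 (col' ord0 (ribbon_mx [:: x, z & s])) = ribbon_mx (z :: s).
  by apply/matrixP => i j; rewrite !mxE.
have minor1 : row' (lift ord0 ord0) (col' ord0 (ribbon_mx [:: x, z & s])) =
    ribbon_mx (x + z :: s)%N.
  apply/matrixP => i j; rewrite !mxE; congr q.
  by case: (unliftP ord0 i) => [i'|] ->; rewrite //= addnA.
rewrite (ribbonQ_det c) (ribbonQ_det c1) (ribbonQ_det c2) -minor0 -minor1 -M00.
exact: det_col0_two.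
Qed.

(** * The homomorphism *)

Lemma q_QOmega n : q n%:Z \in QOmega_pred.
Proof.
apply/Omega_spanP/Omega_span_incl; case: n => [|n]; first exact: Omega_1.
exact: Omega_q.
Qed.

Definition qO n : QOmega := QOmegaElt (q_QOmega n).

Definition qword (w : {fmonom nat}) : QOmega := \prod_(k <- (w : seq nat)) qO k.+1.

Fact qword_mmorphism : mmorphism qword.
Proof. by split=> [v w|]; rewrite /qword ?fmM ?fm1 ?big_cat ?big_nil. Qed.

HB.instance Definition _ :=
  isMultiplicative.Build {fmonom nat} QOmega qword qword_mmorphism.

(** The map given by the universal property of the free algebra. *)
Definition evalq : NC -> QOmega := mmap (in_alg QOmega) qword.
HB.instance Definition _ := GRing.RMorphism.copy evalq (mmap (in_alg QOmega) qword).

Lemma evalq_y n : evalq (y n) = qO n.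
Proof.
case: n => [|n]; last first.
  by rewrite /evalq /y mmapU /= scale1r mul1r /qword fmU big_seq1.
by rewrite rmorph1; apply: val_inj.
Qed.

Lemma evalqZ c f : evalq (c *: f) = c *: evalq f.
Proof. by rewrite /evalq mmapZ mulr_algl. Qed.

Lemma evalq_chi m : (0 < m)%N -> evalq (chi m) = 0.
Proof.
move=> m0; apply: val_inj; rewrite rmorph0 -(q_rel m0) /chi.
rewrite [evalq _]rmorph_sum rmorph_sum.
apply: eq_bigr => r _.
by rewrite !rmorphM !rmorphXn !rmorphN1 /= !evalq_y.
Qed.

Lemma evalq_ideal f : Eulerian_ideal f -> evalq f = 0.
Proof.
elim=> [|m a b g m0 _ IH]; first exact: rmorph0.
by rewrite rmorphD /= IH !rmorphM /= evalq_chi ?double_gt0 // mulr0 mul0r addr0.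
Qed.

(** * Descent to the quotient [AE] *)

Definition flag_morph (u : AE) : QOmega := evalq (repr u).

(** Well-definedness: the chosen representative differs from f by an element of the ideal, which
    [evalq] kills. *)
Lemma flag_morph_pi f : flag_morph (\pi_AE f) = evalq f.
Proof.
apply/eqP; rewrite -subr_eq0 -rmorphB; apply/eqP/evalq_ideal.
exact: piAE_repr.
Qed.

Fact flag_morph_is_additive : zmod_morphism flag_morph.
Proof.
(* The opposite becomes a scaling by -1, which [piAE_scale] moves inside [\pi_AE]. *)
move=> u v; rewrite -[u]reprK -[v]reprK -[- \pi_AE _]scaleN1r.
rewrite -[_ *: _]/(AE_scale _ _) piAE_scale -piAE_add !flag_morph_pi.
by rewrite rmorphD /= evalqZ scaleN1r.
Qed.

Fact flag_morph_is_multiplicative : monoid_morphism flag_morph.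
Proof.
split=> [|u v]; first by rewrite -[1]/(\pi_AE 1) flag_morph_pi rmorph1.
rewrite -[u]reprK -[v]reprK -[_ * _]/(AE_mul _ _) piAE_mul !flag_morph_pi.
exact: rmorphM.
Qed.

Fact flag_morph_is_scalable : scalable flag_morph.
Proof.
move=> c u; rewrite -[u]reprK -[_ *: _]/(AE_scale _ _) piAE_scale.
by rewrite !flag_morph_pi evalqZ.
Qed.

HB.instance Definition _ :=
  GRing.isZmodMorphism.Build AE QOmega flag_morph flag_morph_is_additive.
HB.instance Definition _ :=
  GRing.isMonoidMorphism.Build AE QOmega flag_morph flag_morph_is_multiplicative.
HB.instance Definition _ :=
  GRing.isScalable.Build rat AE QOmega *:%R flag_morph flag_morph_is_scalable.

Lemma evalq_hcomp a : composition a -> val (evalq (hcomp a)) = ribbonQ a.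
Proof.
rewrite -[hcomp a]/(flag_h y a).
(* Induction on the length, since [x + z :: s] is one part shorter but not a tail of the
   composition. *)
have [n] := ubnP (size a); elim: n a => // n IH [|x [|z s]] /=.
- by rewrite flag_h_nil ribbonQ_nil rmorph1.
- by rewrite andbT flag_h_seq1 evalq_y => _ /ribbonQ_seq1->.
rewrite !ltnS => sz; case/and3P=> x0 z0 cs.
rewrite flag_h_cons2 // ribbonQ_cons2 /= ?x0 ?z0 //.
rewrite -(IH (z :: s)) /= ?z0 // -(IH (x + z :: s)%N) /= ?addn_gt0 ?x0 //.
move: (flag_h y (z :: s)) (flag_h y _) => u v.
by rewrite !rmorphB !rmorphM /= evalq_y.
Qed.

Theorem theorem5p1 :
  exists psi : {lrmorphism AE -> QOmega},
    [/\ forall i : nat, QOmega_val (psi (\pi_AE (y i))) = q i%:Z,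
        forall a : seq nat, composition a ->
          QOmega_val (psi (\pi_AE (ycomp a))) = \prod_(k <- a) q k%:Z
      & forall a : seq nat, composition a ->
          QOmega_val (psi (\pi_AE (hcomp a))) = ribbonQ a].
Proof.
exists flag_morph; split=> [i|a _|a ca] /=; rewrite flag_morph_pi.
- by rewrite evalq_y.
- rewrite -[LHS]/(val _) !rmorph_prod /=.
  by apply: eq_bigr => k _; rewrite evalq_y.
- exact: evalq_hcomp.
Qed.
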